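(* Let $G$ be a finite Meyniel graph without isolated vertices and let $\mathcal{C}=\mathrm{cl}(G)$ be its clique clutter. If $\mathcal{C}$ is ideal, then $\mathcal{C}$ has the max-flow min-cut property.
   Context: A Meyniel graph is a simple graph in which every odd cycle of length at least five has at least two chords, where a chord of a cycle is an edge of the graph joining two vertices of the cycle that are not adjacent in the cycle. A clique of a graph is a set of mutually adjacent vertices. The clique clutter $\mathrm{cl}(G)$ is the clutter on the vertex set $V(G)=\{x_1,\ldots,x_n\}$ whose edges are the inclusion-maximal cliques of $G$ (a clutter being a family of subsets, called edges, none containing another). The clutter matrix $A$ of a clutter on $\{x_1,\ldots,x_n\}$ is the $0/1$ matrix with $n$ rows whose columns are the characteristic vectors of the edges. A clutter with clutter matrix $A$ is ideal if the polyhedron $Q(A)=\{x\mid x\ge 0;\ xA\ge\mathbf{1}\}$ has only integral vertices, where $\mathbf{1}$ is the all-ones vector. It has the max-flow min-cut property (is MFMC) if the linear program $\max\{\langle\mathbf{1},y\rangle\mid y\ge 0,\ Ay\le w\}$ has an integral optimal solution for every $w\in\mathbb{N}^n$, $\mathbb{N}=\{0,1,2,\ldots\}$. *)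

(* Defs.v *)
From mathcomp Require Import all_boot all_order all_algebra.
From mathcomp Require Import reals.

Set Implicit Arguments.
Unset Strict Implicit.
Unset Printing Implicit Defensive.

Import Order.TTheory GRing.Theory Num.Theory.
Local Open Scope ring_scope.

(* A finite simple graph on the vertices x_1, ..., x_n is a symmetric and
   irreflexive relation e : rel 'I_n; a clutter is its set of edges,
   C : {set {set 'I_n}}.  For n = 0 the empty set would be a maximal clique, and
   the clique clutter {set0} is vacuously ideal but its packing program is
   unbounded: graphs are meant to have 0 < n. *)

Section Graphs.
Variables (n : nat) (e : rel 'I_n).

(* A chord is an unordered pair, so that it is counted only once. *)
Definition chords (c : seq 'I_n) : {set {set 'I_n}} :=
  [set [set x; y] | x in c, y in c &
     [&& e x y, y != next c x & x != next c y]].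

Definition meyniel : Prop :=
  forall c : seq 'I_n,
    ucycle e c -> odd (size c) -> (5 <= size c)%N -> (2 <= #|chords c|)%N.

Definition no_isolated_vertex : Prop := forall x, exists y, e x y.

Definition is_clique (K : {set 'I_n}) : bool :=
  [forall x in K, forall y in K, (x != y) ==> e x y].

Definition clique_clutter : {set {set 'I_n}} :=
  [set K | maxset is_clique K].

End Graphs.

Definition is_clutter (n : nat) (C : {set {set 'I_n}}) : Prop :=
  forall E F, E \in C -> F \in C -> E \subset F -> E = F.

Lemma clique_clutter_is_clutter n (e : rel 'I_n) :
  is_clutter (clique_clutter e).
Proof.
move=> E F; rewrite !inE => /maxsetP[_ maxE] /maxsetP[clF _] sEF.
by rewrite (maxE F).
Qed.

Section Polyhedra.
Variable R : realType.

Definition clutter_matrix n (C : {set {set 'I_n}}) : 'M[R]_(n, #|C|) :=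
  \matrix_(i < n, j < #|C|) (i \in (enum_val j : {set 'I_n}))%:R.

Definition integral_mx p q (M : 'M[R]_(p, q)) : Prop :=
  forall i j, M i j \is a Num.int.

(* The vertices of a polyhedron P are its extreme points. *)
Definition is_vertex n (P : 'rV[R]_n -> Prop) (v : 'rV[R]_n) : Prop :=
  P v /\
  forall (x y : 'rV[R]_n) (t : R), P x -> P y -> 0 < t < 1 ->
    v = t *: x + (1 - t) *: y -> x = v /\ y = v.

Definition covering_polyhedron n m (A : 'M[R]_(n, m)) (x : 'rV[R]_n) : Prop :=
  (forall i, 0 <= x 0 i) /\ (forall j, 1 <= (x *m A) 0 j).

Definition ideal n (C : {set {set 'I_n}}) : Prop :=
  forall v, is_vertex (covering_polyhedron (clutter_matrix C)) v ->
    integral_mx v.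

Definition packing_feasible n m (A : 'M[R]_(n, m)) (w : 'cV[nat]_n)
    (y : 'cV[R]_m) : Prop :=
  (forall j, 0 <= y j 0) /\ (forall i, (A *m y) i 0 <= (w i 0)%:R).

Definition packing_optimal n m (A : 'M[R]_(n, m)) (w : 'cV[nat]_n)
    (y : 'cV[R]_m) : Prop :=
  packing_feasible A w y /\
  forall z, packing_feasible A w z -> \sum_j z j 0 <= \sum_j y j 0.

Definition mfmc n (C : {set {set 'I_n}}) : Prop :=
  forall w : 'cV[nat]_n,
    exists y, packing_optimal (clutter_matrix C) w y /\ integral_mx y.

End Polyhedra.

(* Main.v *)
Require Import Defs.
From mathcomp Require Import all_boot all_order all_algebra.
From mathcomp Require Import reals boolp zify lra.

Set Implicit Arguments.
Unset Strict Implicit.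
Unset Printing Implicit Defensive.

(** Write C for the clique clutter of G, and let tau be the least weight of a
    hitting set of C under the integer weights w. It suffices to produce tau
    maximal cliques covering each vertex v at most w v times, since no packing
    exceeds the weight of a hitting set. This goes by induction on the total
    weight.

    If lowering the weight of some vertex by 1 keeps tau, induction applies.
    Otherwise each vertex of positive weight lies on a hitting set of weight
    tau. Then no stable set S of such vertices weighs more than tau. This is
    clear if S is a single vertex; otherwise add up such hitting sets, one for
    each vertex of S, and subtract S. A clique meets S at most once, so after
    division by #|S| - 1 this is a point of the covering polyhedron Q(A), of
    cost less than tau if S weighs more than tau. Some vertex of Q(A) costs no
    more ([covering_vertex]), and ideality makes this vertex integral, hence a
    hitting set lighter than tau ([ideal_hitting_set]).

    By perfection ([weighted_clique_cover]) there are at most tau cliques, not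
    yet known to be maximal, that cover each v exactly w v times. Suppose that
    one of them, K0, extends by a vertex u, and let H be the set of vertices of
    positive weight. By very strong perfection some stable set S of u |: H
    contains u and meets all maximal cliques of G[u |: H]. Then S together with
    the vertices of weight 0 is a hitting set of C, so S weighs at least tau;
    but each clique of the cover meets S at most once and K0 misses S, so S
    weighs less than tau. Hence the cover is a packing of maximal cliques.

    That a Meyniel graph is very strongly perfect, i.e. that every vertex of
    every induced subgraph lies in a stable set meeting all its maximal cliques,
    is a theorem of Hoang; the proof here uses the contractions of Hertz
    ([tip_strong_stable]). Perfection then follows as in Lovasz's argument:
    strong stable sets give weighted colourings, and a weighted colouring of a
    family of stable sets shows that some clique meets all the heaviest stable
    sets. *)

(** * Fans over almost induced paths *)

(* Every boolean atom in a hypothesis makes lia branch, hence the clearing of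
   the hypotheses that are not about natural numbers. *)
Ltac arith_prop P :=
  lazymatch P with
  | is_true (leq _ _) => idtac
  | is_true (leq _ _ && leq _ _) => idtac
  | is_true (odd _) => idtac
  | is_true (~~ odd _) => idtac
  | odd _ = _ => idtac
  | @eq nat _ _ => idtac
  | ~ @eq nat _ _ => idtac
  end.
Ltac arith :=
  repeat match goal with
  | H : ?P |- _ =>
    lazymatch type of P with Prop => idtac end;
    tryif arith_prop P then fail else clear H
  end; lia.

Section Tip.
Variable T : finType.
Implicit Types (r : rel T) (f p : nat -> T) (u v w s d q : T) (A Q S : {set T}).

(** The odd cycle f 0, ..., f m.-1 has at most one chord, namely uv: this is
    what a Meyniel graph excludes. Taking u = v excludes all chords. *)
Record near_hole r f m u v : Prop := NearHole {
  nh_odd : odd m;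
  nh_size : 5 <= m;
  nh_inj : forall i j, i < m -> j < m -> f i = f j -> i = j;
  nh_step : forall i, i.+1 < m -> r (f i) (f i.+1);
  nh_close : r (f m.-1) (f 0);
  nh_chord : forall i j, i < j -> j < m -> r (f i) (f j) ->
    [\/ j = i.+1, i = 0 /\ j = m.-1 | f i = u /\ f j = v] }.

(** The quasi-Meyniel graphs of Hertz with tip w: there is no odd hole, and in
    an odd cycle with a single chord, the tip is an end of that chord. It is
    this weakening that the contractions below preserve. A cycle through the tip
    is listed from the tip on, whence the condition on positive indices. *)
Definition quasi_meyniel r w : Prop := forall f m u v,
  near_hole r f m u v -> (forall i, 0 < i < m -> f i != w) ->
  u != w -> v != w -> False.

(** A path from p 0 to p L with at most one chord, between u and v. *)
Record near_path r p L u v : Prop := NearPath {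
  np_inj : forall i j, i <= L -> j <= L -> p i = p j -> i = j;
  np_step : forall i, i < L -> r (p i) (p i.+1);
  np_chord : forall i j, i < j -> j <= L -> r (p i) (p j) ->
    j = i.+1 \/ p i = u /\ p j = v }.

(** Letting the exceptional pair vary rules out all chords and makes every
    lemma on almost induced paths apply verbatim. *)
Definition induced_path r p L := forall u v, near_path r p L u v.

(** Identification of s with w. The vertex s is kept as an isolated vertex, so
    that the vertex type does not change. *)
Definition contract r w s : rel T := [rel x y | [&& x != s, y != s &
  if x == w then r w y || r s y else if y == w then r x w || r x s else r x y]].

Lemma contractE r w s x y : x != w -> y != w -> x != s -> y != s ->
  contract r w s x y = r x y.
Proof. by rewrite /contract /= => /negbTE-> /negbTE-> -> ->. Qed.

Lemma contract_tip r w s y : s != w -> y != w -> y != s ->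
  contract r w s w y = r w y || r s y.
Proof. by move=> sw yw ys; rewrite /contract /= eqxx ys eq_sym sw. Qed.

Lemma contract_sym r w s : symmetric r -> symmetric (contract r w s).
Proof.
move=> r_sym x y; rewrite /contract /=.
case: (eqVneq x w) (eqVneq y w) => [->|xw] [->|yw] //.
- by rewrite andbCA (r_sym w) (r_sym s).
- by rewrite andbCA !(r_sym x).
- by rewrite andbCA (r_sym x).
Qed.

Lemma next_true (f : pred nat) t L : t < L -> f L ->
  exists b, [/\ t < b <= L, f b & forall i, t < i < b -> ~~ f i].
Proof.
move=> tL fL; have ex : exists b, (t < b) && f b by exists L; rewrite tL.
case: (ex_minnP ex) => b /andP[tb fb] min; exists b; split=> //.
  by rewrite tb min // tL.
by move=> i /andP[ti ib]; apply/negP => fi; have := min i; rewrite ti fi; arith.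
Qed.

Lemma prev_true (f : pred nat) t : 0 < t -> f 0 ->
  exists a, [/\ a < t, f a & forall i, a < i < t -> ~~ f i].
Proof.
move=> t0 f0; have ex : exists a, (a < t) && f a by exists 0; rewrite t0.
case: (@ex_maxnP _ t ex) => [i /andP[]|a /andP[at_ fa] max]; first by arith.
exists a; split=> // i /andP[ai it].
by apply/negP => fi; have := max i; rewrite it fi; arith.
Qed.

Section Fan.
Variables (r : rel T) (w : T).
Hypotheses (r_sym : symmetric r) (r_irr : irreflexive r).
Hypothesis (r_qm : quasi_meyniel r w).

(** The source of all contradictions: d and the segment p x, ..., p y form an
    odd cycle, with d listed last so that the tip, if it is there, is p 0. *)
Lemma fan_cycle p d x y u v :
  x + 3 <= y -> odd (y - x) ->
  (forall i j, x <= i <= y -> x <= j <= y -> p i = p j -> i = j) ->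
  (forall i, x <= i < y -> r (p i) (p i.+1)) ->
  (forall i, x < i <= y -> p i != w) -> d != w ->
  (forall i, x <= i <= y -> p i != d) ->
  r d (p x) -> r d (p y) ->
  (forall i j, x <= i -> i < j -> j <= y -> r (p i) (p j) ->
     j = i.+1 \/ p i = u /\ p j = v) ->
  (forall t, x < t < y -> r d (p t) -> p t = u /\ d = v) ->
  u != w -> v != w -> False.
Proof.
move=> xy odd_yx inj step pw dw pd dx dy pch dch.
pose f i := if i <= y - x then p (x + i) else d.
have f_in i : i <= y - x -> f i = p (x + i) by rewrite /f => ->.
have f_out i : y - x < i -> f i = d by rewrite /f ltnNge => /negbTE ->.
apply: (r_qm (f := f) (m := (y - x).+2) (u := u) (v := v)); last first.
  move=> i /andP[i0 im]; case: (leqP i (y - x)) => h; last by rewrite f_out.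
  by rewrite f_in //; apply: pw; arith.
split.
- by rewrite /= negbK.
- by arith.
- move=> i j im jm; case: (leqP i (y - x)) => hi; case: (leqP j (y - x)) => hj.
  + by rewrite !f_in // => /inj; arith.
  + by rewrite f_in // f_out // => /eqP; rewrite (negbTE (pd _ _)) //; arith.
  + rewrite f_out // f_in // => /eqP; rewrite eq_sym (negbTE (pd _ _)) //; arith.
  + by arith.
- move=> i im; case: (leqP i.+1 (y - x)) => hi.
    by rewrite !f_in ?addnS; [apply: step| |]; arith.
  rewrite f_in; last by arith.
  by rewrite f_out // r_sym (_ : x + i = y) //; arith.
- by rewrite /= f_out // f_in // addn0.
- move=> i j ij jm; case: (leqP j (y - x)) => hj.
    rewrite !f_in //; last by arith.
    by case/pch; [arith|arith|arith|move=> e; constructor 1; arith|constructor 3].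
  rewrite (f_out j) // f_in; last by arith.
  case: (posnP i) => [->|i0]; first by move=> _; constructor 2; arith.
  case: (ltngtP i (y - x)) => hi; [|by arith|by move=> _; constructor 1; arith].
  by rewrite r_sym => /dch[]; [arith|constructor 3].
Qed.

Section Spanning.
Variables (p : nat -> T) (L : nat) (u v d : T).
Hypotheses (pP : near_path r p L u v) (p0 : p 0 = w).
Hypotheses (uw : u != w) (vw : v != w).
Hypotheses (pd : forall i, i <= L -> p i != d) (d0 : r d (p 0)).

Let pw i : 0 < i <= L -> p i != w.
Proof.
move=> iL; apply/eqP => e.
by have := @np_inj _ _ _ _ _ pP i 0 _ _ (etrans e (esym p0)); arith.
Qed.

Let dw : d != w. Proof. by rewrite -p0 eq_sym pd. Qed.

(** Two consecutive neighbours of d on the path are adjacent or at even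
    distance: otherwise they close an odd cycle with d. *)
Lemma fan_gap x y : x + 3 <= y -> odd (y - x) -> y <= L ->
  r d (p x) -> r d (p y) -> (forall t, x < t < y -> ~~ r d (p t)) -> False.
Proof.
move=> xy o yL dx dy no.
apply: (@fan_cycle p d x y u v) => //.
- by move=> i j *; apply: (np_inj pP) => //; arith.
- by move=> i *; apply: (np_step pP); arith.
- by move=> i *; apply: pw; arith.
- by move=> i *; apply: pd; arith.
- by move=> i j *; apply: (np_chord pP) => //; arith.
- by move=> t /no /negbTE->.
Qed.

(** If a single inner vertex p t0 of an induced segment of odd length were a
    neighbour of d, there would be an odd cycle with a single chord, from d to
    p t0. *)
Lemma fan_spoke x y t0 : x + 3 <= y -> odd (y - x) -> y <= L ->
  r d (p x) -> r d (p y) -> 0 < t0 <= L ->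
  (forall t, x < t < y -> r d (p t) -> t = t0) ->
  (forall i j, x <= i -> i < j -> j <= y -> r (p i) (p j) -> j = i.+1) -> False.
Proof.
move=> xy o yL dx dy t0L spoke ind.
apply: (@fan_cycle p d x y (p t0) d) => //.
- by move=> i j *; apply: (np_inj pP) => //; arith.
- by move=> i *; apply: (np_step pP); arith.
- by move=> i *; apply: pw; arith.
- by move=> i *; apply: pd; arith.
- by move=> i j *; left; apply: ind.
- by move=> t tt /(spoke _ tt)->.
- exact: pw.
Qed.

Hypothesis (dL : r d (p L)).

(** The first neighbour p t of d with t odd directly follows another
    neighbour p b, by [fan_gap]; the neighbour p a before p b is not adjacent
    to p b on the path, as a and b are even. *)
Lemma fan_odd : odd L -> ~~ r d (p 1) ->
  exists a b, [/\ a.+2 <= b, b < L & ~~ odd a && ~~ odd b] /\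
   [/\ r d (p a), r d (p b), r d (p b.+1) &
       forall t, a < t < b -> ~~ r d (p t)] /\
   forall t, t <= b -> r d (p t) -> ~~ odd t.
Proof.
move=> oL d1.
have ex : exists t, odd t && r d (p t) by exists L; rewrite oL.
case: (ex_minnP ex) => t /andP[ot dt] tmin.
have tL : t <= L by apply: tmin; rewrite oL.
have even i : i < t -> r d (p i) -> ~~ odd i.
  by move=> it di; apply/negP => oi; have := tmin i; rewrite oi di; arith.
have t1 : t <> 1 by move=> e; move: dt; rewrite e (negbTE d1).
have [|b [bt db nb]] := @prev_true (fun i => r d (p i)) t _ d0; first by arith.
have ob := even _ bt db.
have tb : t = b.+1.
  case: (t =P b.+1) => // ne; exfalso.
  by apply: (@fan_gap b t) => //; arith.
have b0 : b <> 0.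
  by move=> e; move: dt; rewrite tb e (negbTE d1).
have [|a [ab da na]] := @prev_true (fun i => r d (p i)) b _ d0; first by arith.
have oa : ~~ odd a by apply: even => //; arith.
exists a, b; split; first by split; rewrite ?oa ?ob //; arith.
split; first by rewrite -tb.
by move=> i ib; apply: even; arith.
Qed.

End Spanning.

Lemma induced_chord p L : induced_path r p L ->
  forall i j, i < j -> j <= L -> r (p i) (p j) -> j = i.+1.
Proof.
move=> pI i j ij jL rij.
case: (pI (p j) (p j)) => inj _ /(_ i j ij jL rij) [//|[eij _]].
by have := inj i j _ _ eij; arith.
Qed.

(** If d saw p 1 but not p 2, let p b be its next neighbour. Its distance to
    p 1 is even by [fan_gap], and then the cycle through d, p 0, ..., p b is
    odd with the single chord from d to p 1. *)
Lemma fan_first p L d z : induced_path r p L -> p 0 = w -> z != w ->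
  (forall i, i <= L -> p i != d) -> r d (p 0) -> r d (p L) -> 2 <= L ->
  ~~ r d (p 2) -> ~~ r d (p 1).
Proof.
move=> pI p0 zw pd d0 dL L2 d2; apply/negP => d1.
have pP := pI z z; have ind := induced_chord pI.
have [|b [bL db nb]] := @next_true (fun i => r d (p i)) 1 L _ dL; first by arith.
have b2 : b <> 2 by move=> e; move: db; rewrite e (negbTE d2).
case ob : (odd b); last first.
  by apply: (fan_gap pP p0 zw zw pd (x := 1) (y := b)) => //; arith.
apply: (fan_spoke pP p0 pd (x := 0) (y := b) (t0 := 1)) => //; try arith.
  move=> t tb dt; case: (ltngtP t 1) => ht //; [arith|].
  by move: dt; rewrite (negbTE (nb _ _)) //; arith.
by move=> i j _ ij jb; apply: ind => //; arith.
Qed.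

(** The path that takes the chord from p i to p j. *)
Definition shortcut p i j t := p (if t <= i then t else t + (j - i).-1).

Lemma shortcut_induced p L i j : near_path r p L (p i) (p j) ->
  r (p i) (p j) -> i < j <= L -> induced_path r (shortcut p i j) (L - (j - i).-1).
Proof.
move=> pP rij ijL u v; have inj := np_inj pP; rewrite /shortcut; split.
- by move=> x y xL yL /inj; case: (leqP x i) => ?; case: (leqP y i) => ?; arith.
- move=> x xL; case: (ltngtP x i) => hx.
  + by apply: (np_step pP); arith.
  + by rewrite addSn; apply: (np_step pP); arith.
  + by rewrite hx (_ : i.+1 + _ = j) //; arith.
- move=> x y xy yL h; left; move: h.
  case: (leqP x i) => hx; case: (leqP y i) => hy; [| |arith|].
  + by case/(np_chord pP); [arith|arith|arith|case=> _ /inj; arith].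
  + case/(np_chord pP); [arith|arith|arith|].
    by case=> /inj ex /inj ey; move: ex ey; arith.
  + case/(np_chord pP); [arith|arith|arith|].
    by case=> /inj ex /inj ey; move: ex ey; arith.
Qed.

(** * Identifying the tip with a non-neighbour *)

Section Contraction.
Variable s : T.
Hypothesis (ws : ~~ r w s).
(* This holds when s, among the non-neighbours of w, has the most common
   neighbours with w: q cannot have c and all those of s. *)
Hypothesis (s_max : forall q c, q != w -> ~~ r w q -> r w c -> r q c ->
  ~~ r s c -> exists d, [/\ r w d, r s d & ~~ r q d]).

(** Since p 2 is a non-neighbour of w and is adjacent to p 1, which s does not
    see, some common neighbour d of w and s misses p 2. Then d misses p 1 by
    [fan_first], and the two neighbours found by [fan_odd] close an odd cycle
    with a single chord. *)
Lemma induced_even p L : p 0 = w -> p L = s -> 3 <= L ->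
  induced_path r p L -> odd L -> False.
Proof.
move=> p0 pL L3 pI oL; have pP := pI w w.
have ind := induced_chord pI.
have inj := np_inj pP.
have nr i j : i.+1 < j -> j <= L -> ~~ r (p i) (p j).
  by move=> ij jL; apply/negP => /ind; arith.
have [|||||d [dw ds dq]] := s_max (q := p 2) (c := p 1).
- by apply/eqP; rewrite -p0 => /inj; arith.
- by rewrite -p0 nr //; arith.
- by rewrite -p0; apply: (np_step pP); arith.
- by rewrite r_sym; apply: (np_step pP); arith.
- by rewrite -pL r_sym nr.
have pd i : i <= L -> p i != d.
  move=> iL; apply/eqP => e.
  case: (posnP i) => i0; first by move: dw; rewrite -e i0 p0 r_irr.
  have := nr 0 i; have := nr i L; rewrite e pL p0 dw (r_sym d) ds.
  case: (ltngtP i 1) => hi; [arith | by move=> _ /(_ isT iL)|].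
  by rewrite hi => /(_ L3 (leqnn _)).
have ws' : s != w by rewrite -pL -p0; apply/eqP => /inj; arith.
have pP' := pI s s.
have d0 : r d (p 0) by rewrite p0 r_sym.
have dL : r d (p L) by rewrite pL r_sym.
have d2 : ~~ r d (p 2) by rewrite r_sym.
have d1 := fan_first pI p0 ws' pd d0 dL (ltnW L3) d2.
have [a [b [[ab bL /andP[oa ob]] [[da db db1 nab] _]]]] :=
  fan_odd pP' p0 ws' ws' pd d0 dL oL d1.
apply: (fan_spoke pP' p0 pd (x := a) (y := b.+1) (t0 := b)) => //; try arith.
  move=> t tb dt; case: (ltngtP t b) => ht //; [|arith].
  by move: dt; rewrite (negbTE (nab _ _)) //; arith.
by move=> i j _ ij jb; apply: ind => //; arith.
Qed.


(** As for induced paths, but with the triangle p i, p i.+1, p i.+2, which the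
    induced path p' avoids. A common neighbour d of w and s that misses the
    third vertex of p' sees, by [fan_odd], p a, p b and p b.+1 and nothing
    between p a and p b. Where the triangle lies with respect to this segment
    decides which of p and p' carries the forbidden odd cycle. *)
Lemma near_path_triangle p L i : p 0 = w -> p L = s ->
  0 < i -> near_path r p L (p i) (p i.+2) -> r (p i) (p i.+2) -> odd L ->
  p i != w -> p i.+2 != w -> p i != s -> i.+2 < L -> False.
Proof.
move=> p0 pL i0 pP rii oL uw vw us iL; have inj := np_inj pP.
have nr x y : x.+1 < y -> y <= L -> x <> i \/ y <> i.+2 -> ~~ r (p x) (p y).
  move=> xy yL xi; apply/negP => /(np_chord pP)[]; [arith|arith|arith|].
  by case=> /inj ex /inj ey; move: ex ey xi; arith.
have p'I : induced_path r (shortcut p i i.+2) L.-1.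
  have := shortcut_induced pP rii; rewrite subSn // subSnn /= subn1; apply; arith.
set p' := shortcut p i i.+2 in p'I.
have p'le x : x <= i -> p' x = p x by rewrite /p' /shortcut => ->.
have p'gt x : i < x -> p' x = p x.+1.
  by move=> ix; rewrite /p' /shortcut leqNgt ix subSn // subSnn /= addn1.
have p'0 : p' 0 = w by rewrite p'le.
have p'L : p' L.-1 = s by rewrite p'gt ?prednK //; arith.
have ind' := induced_chord p'I.
have p'1 : p' 1 = p 1 by rewrite p'le.
have sw : s != w by rewrite -pL -p0; apply/eqP => /inj; arith.
have [|||||d [dw ds dq]] := s_max (q := p' 2) (c := p' 1).
- by apply/eqP; rewrite -p'0 => /(np_inj (p'I s s)); arith.
- by apply/negP; rewrite -p'0 => /ind'; arith.
- by rewrite -p'0; apply: (np_step (p'I s s)); arith.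
- by rewrite r_sym; apply: (np_step (p'I s s)); arith.
- by rewrite p'1 -pL r_sym nr; arith.
have pd x : x <= L -> p x != d.
  move=> xL; apply/eqP => e.
  case: (posnP x) => x0; first by move: dw; rewrite -e x0 p0 r_irr.
  have := nr 0 x; rewrite p0 e dw => h.
  have x1 : x = 1 by move: h => /=; arith.
  by have := nr 1 L; rewrite -x1 pL e (r_sym d) ds /=; arith.
have p'd x : x <= L.-1 -> p' x != d.
  by move=> xL; rewrite /p' /shortcut; case: ifP => _; apply: pd; arith.
have d0 : r d (p 0) by rewrite p0 r_sym.
have dL : r d (p L) by rewrite pL r_sym.
have d0' : r d (p' 0) by rewrite p'0 r_sym.
have dL' : r d (p' L.-1) by rewrite p'L r_sym.
have d1 : ~~ r d (p 1).
  by rewrite -p'1 (fan_first p'I p'0 sw p'd) //; [arith | rewrite r_sym].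
have [a [b [[ab bL /andP[oa ob]] [[da db db1 nab] even]]]] :=
  fan_odd pP p0 uw vw pd d0 dL oL d1.
have [[ai1 ib1]|out] : a <= i /\ i <= b.-1 \/ ~ (a <= i /\ i <= b.-1) by arith.
2: {
  (* the triangle does not lie between p a and p b.+1 *)
  apply: (fan_spoke pP p0 pd (x := a) (y := b.+1) (t0 := b)) => //; try arith.
    move=> t tb dt; case: (ltngtP t b) => ht //; [|arith].
    by move: dt; rewrite (negbTE (nab _ _)) //; arith.
  move=> x y ax xy yb /(np_chord pP)[]; [arith|arith|arith|].
  by case=> /inj ex /inj ey; move: ex ey out; arith. }
have [ib|ib] : i.+2 <= b \/ b = i.+1 by arith.
- (* the triangle lies inside the gap *)
  have p'b : p' b.-1 = p b by rewrite p'gt ?prednK //; arith.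
  have p'a : p' a = p a by rewrite p'le //; arith.
  have nab' t : a < t < b.-1 -> ~~ r d (p' t).
    move=> tab; case: (leqP t i) => ti; rewrite ?(p'le _ ti) ?(p'gt _ ti);
    by apply: nab; arith.
  have [ba|ba] : a + 4 <= b \/ b = a.+2 by arith.
    by apply: (fan_gap (p'I s s) p'0 sw sw p'd (x := a) (y := b.-1));
      rewrite ?p'a ?p'b //; arith.
  have ai : a = i by arith.
  have [|c [ca dc nc]] := @prev_true (fun i => r d (p i)) a _ d0; first by arith.
  have oc : ~~ odd c by apply: even => //; arith.
  have dc' : r d (p' c) by rewrite p'le //; arith.
  have da' : r d (p' a.+1) by rewrite p'gt -?ba //; arith.
  apply: (fan_spoke (p'I s s) p'0 p'd (x := c) (y := a.+1) (t0 := a)) => //;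
    try arith.
    move=> t tb dt; case: (ltngtP t a) => ht //; [|arith].
    by move: dt; rewrite p'le ?(negbTE (nc _ _)) //; arith.
  by move=> x y _ xy ya; apply: ind' => //; arith.
- (* the triangle straddles the end of the gap *)
  subst b.
  have [|c [cL dc nc]] := @next_true (fun i => r d (p i)) i.+2 L _ dL; first by arith.
  have [c3|c3] : c = i.+3 \/ i.+3 < c by arith.
    subst c.
    have da' : r d (p' a) by rewrite p'le.
    have dc' : r d (p' i.+2) by rewrite p'gt //; arith.
    apply: (fan_spoke (p'I s s) p'0 p'd (x := a) (y := i.+2) (t0 := i.+1)) => //;
      try arith.
      move=> t tb dt; case: (ltngtP t i.+1) => ht //; [|arith].
      by move: dt; rewrite p'le ?(negbTE (nab _ _)) //; arith.
    by move=> x y _ xy ya; apply: ind' => //; arith.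
  case oc : (odd c).
    apply: (fan_spoke pP p0 pd (x := i.+1) (y := c) (t0 := i.+2)) => //; try arith.
      move=> t tb dt; case: (ltngtP t i.+2) => ht //; [arith|].
      by move: dt; rewrite (negbTE (nc _ _)) //; arith.
    move=> x y ax xy yb /(np_chord pP)[]; [arith|arith|arith|].
    by case=> /inj ex /inj ey; move: ex ey; arith.
  by apply: (fan_gap pP p0 uw vw pd (x := i.+2) (y := c)) => //; arith.
Qed.

(** If the chord joins vertices at odd distance, the shortcut through it is an
    induced odd path; at distance 2 it makes a triangle; at larger even distance
    it closes an odd hole. *)
Lemma near_path_even p L u v : p 0 = w -> p L = s -> 3 <= L ->
  near_path r p L u v -> odd L ->
  u != w -> v != w -> u != s -> v != s -> False.
Proof.
move=> p0 pL L3 pP oL uw vw us vs; have inj := np_inj pP.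
(* either p is induced, or {u, v} is a genuine chord p i p j *)
have [[i [j [ij jL rij eu ev]]]|no] :
    (exists i j, [/\ i.+1 < j, j <= L, r (p i) (p j), p i = u & p j = v]) \/
    induced_path r p L.
  apply: contrapT => /not_orP[no]; apply=> u' v'; split=> //; first exact: (np_step pP).
  move=> i j ij jL rij; left; case: (np_chord pP ij jL rij) => // -[eu ev].
  case: (j =P i.+1) => // ne; case: no; exists i, j; split=> //; arith.
2: exact: (induced_even p0 pL L3 no oL).
have i0 : 0 < i by case: posnP uw => // i0; rewrite -eu i0 p0 eqxx.
have jL' : j < L.
  by case: (ltngtP j L) vs => // h; [arith | rewrite -ev h pL eqxx].
subst u v.
have ijL : i < j <= L by arith.
have p'I := shortcut_induced pP rij ijL.
set p' := shortcut p i j in p'I; set L' := L - (j - i).-1 in p'I.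
have p'0 : p' 0 = w by rewrite /p' /shortcut.
have p'L : p' L' = s.
  by rewrite /p' /shortcut leqNgt ifN ?pL; [rewrite -pL; congr p|]; arith.
case oij : (odd (j - i)).
  by apply: (induced_even p'0 p'L _ p'I); rewrite /L'; arith.
have [ji|ji] : j = i.+2 \/ i + 4 <= j by arith.
  subst j; apply: (near_path_triangle p0 pL _ pP _ oL uw vw us) => //; arith.
(* the chord closes an odd hole *)
apply: (r_qm (f := fun t => p (i + t)) (m := (j - i).+1) (u := p i) (v := p i)) => //.
  split.
  - by rewrite /= oij.
  - by arith.
  - by move=> x y xm ym /inj; arith.
  - by move=> x xm; rewrite addnS; apply: (np_step pP); arith.
  - by rewrite addn0 r_sym /= subnKC //; arith.
  - move=> x y xy ym /(np_chord pP)[]; [arith|arith|by move=> ?; constructor 1; arith|].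
    by case=> /inj ex /inj ey; constructor 2; move: ex ey => /=; arith.
by move=> x xm; apply/eqP; rewrite -p0 => /inj; arith.
Qed.

Hypothesis sw : s != w.

Lemma no_P4 a b : r w a -> ~~ r s a -> r s b -> ~~ r w b -> ~~ r a b.
Proof.
move=> wa sa sb wb; apply/negP => ab.
pose p i := nth s [:: w; a; b; s] i.
apply: (@induced_even p 3) => // u v.
have aw : a == w = false by apply: contraTF wa => /eqP->; rewrite r_irr.
have as_ : a == s = false by apply: contraTF wa => /eqP->.
have bw : b == w = false by apply: contraTF sb => /eqP->; rewrite r_sym.
have bs : b == s = false by apply: contraTF sb => /eqP->; rewrite r_irr.
have ab' : a == b = false by apply: contraTF ab => /eqP->; rewrite r_irr.
have up : uniq [:: w; a; b; s].
  by rewrite /= !inE ![w == _]eq_sym aw bw (negbTE sw) ab' as_ bs.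
split.
- by move=> i j iL jL /eqP; rewrite nth_uniq // => /eqP.
- by move=> [|[|[|i]]] //=; rewrite /p /= r_sym.
- move=> [|[|[|[|i]]]] [|[|[|[|j]]]] //= _ _; rewrite /p /= ?(negbTE ws) ?(negbTE wb) //;
  first [by left | by rewrite r_sym (negbTE sa)].
Qed.

(** A bad cycle of the contraction that enters the tip from a neighbour of w
    and leaves it to a neighbour of s opens up into a path from w to s. *)
Lemma no_bridge g m u v : odd m -> 5 <= m -> u != w -> v != w ->
  (forall i, 0 < i < m -> g i != w /\ g i != s) ->
  (forall i j, 0 < i < m -> 0 < j < m -> g i = g j -> i = j) ->
  (forall i, 0 < i -> i.+1 < m -> r (g i) (g i.+1)) ->
  (forall i j, 0 < i -> i < j -> j < m -> r (g i) (g j) ->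
    j = i.+1 \/ g i = u /\ g j = v) ->
  (forall i, 0 < i < m -> r w (g i) -> i = 1) ->
  (forall i, 0 < i < m -> r s (g i) -> i = m.-1) ->
  r w (g 1) -> r s (g m.-1) -> False.
Proof.
move=> om m5; wlog [us vs] : u v / u != s /\ v != s.
  move=> WLOG uw vw gws inj step chord wg sg w1 sm.
  have [uvs|] := boolP ((u != s) && (v != s)).
    by move/andP: uvs => uvs; apply: (WLOG u v).
  rewrite negb_and !negbK => uvs.
  have [|g1w g1s] := gws 1; first by arith.
  apply: (WLOG (g 1) (g 1)) => // i j i0 ij jm rij.
  have [|_ gis] := gws i; first by arith.
  have [|_ gjs] := gws j; first by arith.
  case: (chord i j i0 ij jm rij) => [|[ei ej]]; first by left.
  by move: uvs; rewrite -ei -ej (negbTE gis) (negbTE gjs).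
move=> uw vw gws inj step chord wg sg w1 sm.
pose p i := if i == 0 then w else if i < m then g i else s.
have pg i : 0 < i < m -> p i = g i.
  by rewrite /p lt0n => /andP[/negbTE-> ->].
have p0 : p 0 = w by [].
have pm : p m = s by rewrite /p ltnn; case: eqP => //; arith.
have mid i : i <= m -> [\/ i = 0, 0 < i < m | i = m].
  move=> im; case: (posnP i) => i0; first by constructor 1.
  by case: (ltngtP i m) im => h //; [constructor 2 | constructor 3].
apply: (@near_path_even p m u v) => //; first by arith.
split.
- move=> i j im jm; case: (mid i im) => hi; case: (mid j jm) => hj;
  rewrite ?hi ?hj ?pm ?p0 //.
  + by rewrite pg // => e; case: (gws j hj); rewrite -e eqxx.
  + by move=> e; move: sw; rewrite e eqxx.
  + by rewrite pg // => e; case: (gws i hi); rewrite e eqxx.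
  + by rewrite !pg //; apply: inj.
  + by rewrite pg // => e; case: (gws i hi); rewrite e eqxx.
  + by move=> e; move: sw; rewrite e eqxx.
  + by rewrite pg // => e; case: (gws j hj); rewrite -e eqxx.
- move=> i im; case: (posnP i) => [->|i0]; first by rewrite p0 pg //; arith.
  rewrite pg; last by arith.
  case: (ltngtP i.+1 m) => h; [rewrite pg; [exact: step|arith]|arith|].
  by rewrite h pm r_sym (_ : i = m.-1) //; arith.
- move=> i j ij jm.
  have [j_m|j_m] : j = m \/ j < m by arith.
    rewrite j_m pm; case: (posnP i) => [->|i0]; first by rewrite p0 (negbTE ws).
    rewrite pg; last by arith.
    rewrite r_sym.
    by move=> /sg h; left; move: h; arith.
  rewrite (pg j); last by arith.
  case: (posnP i) => [->|i0].
    by rewrite p0 => /wg h; left; move: h; arith.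
  by rewrite pg; [apply: chord | arith].
Qed.

(** A forbidden cycle of the contraction goes through the tip. If the two
    cycle neighbours of the tip are both adjacent to w, or both to s, then
    replacing the tip by w or by s gives a forbidden cycle of r; otherwise
    [no_bridge] applies. *)
Lemma contract_quasi_meyniel : quasi_meyniel (contract r w s) w.
Proof.
move=> f m u v [om m5 inj step close chord] fw uw vw.
have r'E := @contractE r w s; have r'w y := @contract_tip r w s y sw.
have r'sym := contract_sym w s r_sym.
have fs i : i < m -> f i != s.
  move=> im; case: (ltngtP i.+1 m) => h; [|arith|].
    by have := step _ h; rewrite /contract => /and3P[].
  by move: close; rewrite -h /contract => /and3P[].
have fi i : 0 < i < m -> f i != w /\ f i != s.
  by move=> im; split; [exact: fw | apply: fs; arith].
have chord' i j : 0 < i -> i < j -> j < m -> r (f i) (f j) ->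
    j = i.+1 \/ f i = u /\ f j = v.
  move=> i0 ij jm rij; case: (chord i j ij jm); [|by left|arith|by right].
  have [|? ?] := @fi i; first by arith.
  have [|? ?] := @fi j; first by arith.
  by rewrite r'E.
have step' i : 0 < i -> i.+1 < m -> r (f i) (f i.+1).
  move=> i0 im; have := step i im.
  have [|? ?] := @fi i; first by arith.
  have [|? ?] := @fi i.+1; first by arith.
  by rewrite r'E.
have [f0w|f0w] := eqVneq (f 0) w; last first.
  have f0s : f 0 != s by apply: fs; arith.
  apply: (r_qm (f := f) (m := m) (u := u) (v := v)) => //; split=> //.
  - move=> i im; case: (posnP i) => [i0|i0]; last exact: step'.
    have := step i im; rewrite i0; have [|? ?] := @fi 1; first by arith.
    by rewrite r'E.
  - move: close; have [|? ?] := @fi m.-1; first by arith.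
    by rewrite r'E.
  - move=> i j ij jm; have [|? ?] := @fi j; first by arith.
    have [? ?] : f i != w /\ f i != s.
      by case: (posnP i) => [->//|i0]; apply: fi; arith.
    by rewrite -r'E //; apply: chord.
have mid i : 0 < i < m -> r w (f i) || r s (f i) -> i = 1 \/ i = m.-1.
  move=> im h; case: (@chord 0 i); [arith|arith| |by left|by case; right|].
    by have [? ?] := fi _ im; rewrite f0w r'w.
  by rewrite f0w => -[e]; rewrite e eqxx in uw.
have e1 : r w (f 1) || r s (f 1).
  have := @step 0; rewrite f0w; have [|? ?] := @fi 1; first by arith.
  by rewrite r'w //; apply; arith.
have e2 : r w (f m.-1) || r s (f m.-1).
  move: close; rewrite f0w r'sym; have [|? ?] := @fi m.-1; first by arith.
  by rewrite r'w.
have same z : (z == w) || (z == s) -> r z (f 1) -> r z (f m.-1) -> False.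
  move=> zE z1 zm; pose g i := if i == 0 then z else f i.
  have g0 : g 0 = z by [].
  have gf i : 0 < i -> g i = f i by rewrite lt0n /g => /negbTE->.
  have fz i : 0 < i < m -> f i != z.
    by move=> im; have [? ?] := fi i im; case/orP: zE => /eqP->.
  apply: (r_qm (f := g) (m := m) (u := u) (v := v)) => //; last first.
    by move=> i im; rewrite gf; [apply: fw|arith].
  split=> //.
  - move=> i j im jm; case: (posnP i) => [->|i0]; case: (posnP j) => [->|j0] //.
    + by rewrite g0 gf // => e; have := fz j; rewrite j0 jm -e eqxx => /(_ isT).
    + by rewrite g0 gf // => e; have := fz i; rewrite i0 im e eqxx => /(_ isT).
    + by rewrite !gf //; apply: inj.
  - move=> i im; case: (posnP i) => [->|i0]; first by rewrite g0 gf.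
    by rewrite !gf //; apply: step'.
  - by rewrite g0 gf; [rewrite r_sym|arith].
  - move=> i j ij jm; rewrite (gf j); last by arith.
    case: (posnP i) => [->|i0]; last first.
      by rewrite gf // => /chord'[]; [arith|arith|arith|constructor 1|constructor 3].
    rewrite g0 => zj; have [||->|->] := @mid j; first by arith.
    + by case/orP: zE zj => /eqP-> ->; rewrite ?orbT.
    + by constructor 1.
    + by constructor 2.
have one i : 0 < i < m -> r w (f i) -> r s (f i) -> False.
  move=> im wi si; have [|i1|i1] := mid i im; [by rewrite wi| |];
    move: wi si; rewrite i1 => wi si.
    by case/orP: e2 => h; [apply: (same w)|apply: (same s)]; rewrite ?eqxx ?orbT.
  by case/orP: e1 => h; [apply: (same w)|apply: (same s)]; rewrite ?eqxx ?orbT.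
have w1 : 0 < 1 < m by arith.
have wm : 0 < m.-1 < m by arith.
case/orP: e1 => h1; case/orP: e2 => h2.
- by apply: (same w); rewrite ?eqxx.
- apply: (@no_bridge f m u v) => //.
  + by move=> i j ? ? /inj; arith.
  + move=> i im wi; have [|//|e] := mid i im; first by rewrite wi.
    by case: (one m.-1 wm); rewrite -?e // e.
  + move=> i im wi; have [|e|//] := mid i im; first by rewrite wi orbT.
    by case: (one 1 w1); rewrite -?e // e.
- apply: (@no_bridge (fun i => f (m - i)) m v u) => //.
  + by move=> i im; apply: fi; arith.
  + by move=> i j ? ? /inj; arith.
  + by move=> i i0 im; rewrite r_sym -(@subnSK i m); [apply: step'|]; arith.
  + move=> i j i0 ij jm; rewrite r_sym => /chord'[]; [arith|arith|arith|by left; arith|].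
    by case=> -> ->; right.
  + move=> i im wi; have [||e|e] := mid (m - i); [arith|by rewrite wi| |arith].
    by case: (one 1 w1); rewrite // -e.
  + move=> i im wi; have [||e|e] := mid (m - i); [arith|by rewrite wi orbT|arith|].
    by case: (one m.-1 wm); rewrite // -e.
  + by rewrite subn1.
  + by rewrite (_ : m - m.-1 = 1) //; arith.
- by apply: (same s); rewrite ?eqxx ?orbT.
Qed.

End Contraction.
End Fan.

(** * Strong stable sets of Meyniel graphs *)

Definition stable r S := {in S &, forall x y, ~~ r x y}.
Definition clique r Q := {in Q &, forall x y, x != y -> r x y}.

(** Every clique of A that avoids S extends within A, i.e. S meets all maximal
    cliques of A. A strong stable set of the contraction, with s added, will do:
    if a clique extends in the contraction by the tip only, its vertices are all
    adjacent to w or s, and by [no_P4] all of them to w or all of them to s. *)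
Lemma tip_strong_stable k r A w : #|A| <= k ->
  symmetric r -> irreflexive r -> (forall x y, r x y -> x \in A) -> w \in A ->
  quasi_meyniel r w ->
  exists S, [/\ S \subset A, w \in S, stable r S &
    forall Q, Q \subset A -> clique r Q -> [disjoint Q & S] ->
      exists2 x, x \in A :\: Q & {in Q, forall y, r x y}].
Proof.
elim: k r A w => [|k IH] r A w Ak r_sym r_irr rA wA qm.
  by move: Ak; rewrite leqn0 cards_eq0 => /eqP A0; rewrite A0 inE in wA.
pose nonadj := [pred s | [&& s \in A, s != w & ~~ r w s]].
case: (pickP nonadj) => [s1 nonadj1|all_adj]; last first.
  exists [set w]; rewrite sub1set; split; rewrite ?inE ?eqxx //.
    by move=> x y; rewrite !inE => /eqP-> /eqP->; rewrite r_irr.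
  move=> Q QA _; rewrite disjoint_sym disjoints1 => wQ.
  exists w; first by rewrite !inE wQ.
  move=> y yQ; have := all_adj y; rewrite /= (subsetP QA y yQ) /=.
  have -> /= : y != w by apply: contraNneq wQ => <-.
  by move/negbFE.
pose common s := #|[set x | r s x && r w x]|.
have [s /and3P[sA sw ws] smax] := arg_maxnP common nonadj1.
have s_max q c : q != w -> ~~ r w q -> r w c -> r q c ->
    ~~ r s c -> exists d, [/\ r w d, r s d & ~~ r q d].
  move=> qw wq wc qc sc.
  have qA : q \in A by apply: rA qc.
  have := smax q; rewrite /= qA qw wq => /(_ isT) /= le_qs.
  have [/existsP[d /and3P[? ? ?]]|no] :=
    boolP [exists d, [&& r w d, r s d & ~~ r q d]]; first by exists d.
  suff : common s < common q by rewrite ltnNge le_qs.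
  apply: proper_card; apply/properP; split.
    apply/subsetP => d; rewrite !inE => /andP[sd wd]; rewrite wd andbT.
    by move/existsPn/(_ d): no; rewrite wd sd /= negbK.
  by exists c; rewrite !inE wc ?qc // (negbTE sc).
have r's := @contractE r w s; have r'w y := @contract_tip r w s y sw.
have r'sym := contract_sym w s r_sym.
have [|||x y|||S' [S'A wS' S'st S'Q]] := IH (contract r w s) (A :\ s) w.
- by rewrite -ltnS (leq_trans _ Ak) // [X in _ < X](cardsD1 s) sA.
- exact: r'sym.
- move=> x; rewrite /contract /=.
  case: (eqVneq x w) => [->|_]; last by rewrite r_irr !andbF.
  by rewrite r_irr r_sym (negbTE ws) !andbF.
- rewrite !inE /contract /= => /and3P[-> ys].
  by case: eqP => [->//|_]; case: ifP => _; [case/orP|]; apply: rA.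
- by rewrite !inE eq_sym sw.
- exact: contract_quasi_meyniel.
have sS' : s \notin S' by apply/negP => /(subsetP S'A); rewrite !inE eqxx.
have nr_s y : y \in S' -> ~~ r s y.
  move=> yS; have ys : y != s by apply: contraNneq sS' => <-.
  have [->|yw] := eqVneq y w; first by rewrite r_sym.
  by have := S'st w y wS' yS; rewrite r'w // negb_or => /andP[].
have nr_w y : y \in S' -> ~~ r w y.
  move=> yS; have ys : y != s by apply: contraNneq sS' => <-.
  have [->|yw] := eqVneq y w; first by rewrite r_irr.
  by have := S'st w y wS' yS; rewrite r'w // negb_or => /andP[].
exists (s |: S'); split.
- by rewrite subUset sub1set sA (subset_trans S'A) // subD1set.
- by rewrite !inE wS' orbT.
- move=> x y; rewrite !inE => /orP[/eqP->|xS] /orP[/eqP->|yS]; rewrite ?r_irr //.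
  + exact: nr_s.
  + by rewrite r_sym nr_s.
  + have [->|xw] := eqVneq x w; first exact: nr_w.
    have [->|yw] := eqVneq y w; first by rewrite r_sym nr_w.
    by rewrite -r's ?S'st //; [move: xS | move: yS]; apply: contraTneq => ->.
move=> Q QA Qcl QsS'.
have sQ : s \notin Q by rewrite (disjointFl QsS') ?setU11.
have QS' : [disjoint Q & S'] by apply: disjointWr QsS'; apply: subsetUr.
have wQ : w \notin Q by apply: contraL wS' => /(disjointFr QS')->.
have Qws y : y \in Q -> y != w /\ y != s.
  by move=> yQ; split; [move: wQ|move: sQ]; apply: contraNneq => <-.
have split_Q : {in Q, forall y, r w y || r s y} ->
    {in Q, forall y, r w y} \/ {in Q, forall y, r s y}.
  move=> ws_Q; have [/forall_inP h|] := boolP [forall y in Q, r w y]; first by left.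
  case/forall_inPn => b bQ wb; right => a aQ; apply/negPn/negP => sa.
  have wa : r w a by move: (ws_Q a aQ); rewrite (negbTE sa) orbF.
  have sb : r s b by move: (ws_Q b bQ); rewrite (negbTE wb).
  have := no_P4 r_sym r_irr qm ws s_max sw wa sa sb wb.
  by rewrite Qcl //; apply: contraNneq wb => <-.
have extend : {in Q, forall y, r w y || r s y} ->
    exists2 x, x \in A :\: Q & {in Q, forall y, r x y}.
  by move/split_Q => [] h; [exists w|exists s]; rewrite ?inE ?wQ ?sQ.
have [|||x] := S'Q Q.
- by rewrite subsetD1 QA.
- move=> x y xQ yQ xy; have [? ?] := Qws x xQ; have [? ?] := Qws y yQ.
  by rewrite r's ?Qcl.
- by [].
rewrite !inE => /and3P[xQ xs xA] xcl.
have [xw|xw] := eqVneq x w.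
  apply: extend => y yQ; have [? ?] := Qws y yQ.
  by have := xcl y yQ; rewrite xw r'w.
exists x; first by rewrite !inE xQ.
by move=> y yQ; have [? ?] := Qws y yQ; rewrite -r's ?xcl.
Qed.

End Tip.

Section Meyniel.
Variables (n : nat) (e : rel 'I_n).
Hypotheses (e_sym : symmetric e) (e_irr : irreflexive e).

Lemma meyniel_near_hole f m u v : meyniel e -> near_hole e f m u v -> False.
Proof.
move=> mey [om m5 inj step close chord].
case: m om m5 inj step close chord => // k om k5 inj step close chord.
pose c := mkseq f k.+1.
have cE : c = f 0 :: map f (iota 1 k) by [].
have sc : size c = k.+1 by rewrite size_mkseq.
have nth_c i : i < k -> nth (f 0) (map f (iota 1 k)) i = f i.+1.
  by move=> ik; rewrite (nth_map 0) ?size_iota // nth_iota // add1n.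
have uc : uniq c.
  rewrite map_inj_in_uniq ?iota_uniq // => i j.
  by rewrite !mem_iota /= add0n => ik jk; apply: inj.
have cc : cycle e c.
  rewrite cE /= rcons_path; apply/andP; split.
    apply/(pathP (f 0)) => i; rewrite size_map size_iota => ik.
    rewrite nth_c //; case: i ik => [|i] ik; first exact: step.
    by rewrite /= nth_c ?step // ltnW.
  rewrite (last_nth (f 0)) size_map size_iota -cE nth_mkseq //.
have next_c i : i < k.+1 -> next c (f i) = if i < k then f i.+1 else f 0.
  move=> ik; have fc : f i \in c by apply: map_f; rewrite mem_iota.
  have idx : index (f i) c = i.
    by rewrite -[f i](nth_mkseq (f 0) f ik) index_uniq ?sc.
  rewrite next_nth fc idx cE.
  by case: ltnP => h; [rewrite nth_c | rewrite nth_default // size_map size_iota].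
have ucc : ucycle e c by rewrite /ucycle cc.
have := mey c ucc; rewrite sc => /(_ om k5).
rewrite ltnNge => /negP; apply; rewrite -(cards1 [set u; v]) subset_leq_card //.
have chords_uv i j : i < j -> j < k.+1 -> e (f i) (f j) ->
    f j != next c (f i) -> f i != next c (f j) -> [set f i; f j] = [set u; v].
  move=> ij jk eij ni nj; case: (chord i j ij jk eij) => [ji|[i0 jm]|[-> ->]] //.
  - by move: ni; rewrite next_c ?ji ?ifT ?eqxx //; lia.
  - by move: nj; rewrite next_c // i0 jm ltnn eqxx.
have mem_c x : x \in c -> exists2 i, i < k.+1 & x = f i.
  by case/mapP => i; rewrite mem_iota => ik ->; exists i.
apply/subsetP => K /imset2P[x y /mem_c[i ik ->]].
rewrite inE => /andP[/mem_c[j jk ->] /and3P[exy nx ny]] ->; rewrite inE.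
case: (ltngtP i j) => ij.
- by rewrite chords_uv.
- by rewrite setUC chords_uv // e_sym.
- by rewrite ij e_irr in exy.
Qed.

(** Very strong perfection, with maximality of Q in A replaced by the
    extendability of the cliques that avoid S. *)
Definition strong_stable_sets := forall (A : {set 'I_n}) v, v \in A ->
  exists S : {set 'I_n}, [/\ S \subset A, v \in S, stable e S &
    forall Q : {set 'I_n}, Q \subset A -> is_clique e Q -> [disjoint Q & S] ->
      exists2 x, x \in A :\: Q & is_clique e (x |: Q)].

Lemma cliqueP (Q : {set 'I_n}) : reflect (clique e Q) (is_clique e Q).
Proof.
apply: (iffP forall_inP) => [h x y xQ yQ xy|h x xQ].
  by have /forall_inP/(_ y yQ)/implyP-> := h x xQ.
by apply/forall_inP => y yQ; apply/implyP; apply: h.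
Qed.

Lemma meyniel_strong_stable_sets : meyniel e -> strong_stable_sets.
Proof.
move=> mey A v vA.
pose r : rel 'I_n := [rel x y | [&& e x y, x \in A & y \in A]].
have [|x|x y /and3P[]||f m a b|S [SA vS Sst SQ]] //=
    := @tip_strong_stable _ #|A| r A v (leqnn _).
- by move=> x y; rewrite /r /= e_sym andbCA andbC -andbA.
- by rewrite /r /= e_irr.
- move=> [om m5 inj step close chord] _ _ _.
  have fA i : i < m -> f i \in A.
    move=> im; case: (ltngtP i.+1 m) => h; [|lia|].
      by have /and3P[] := step _ h.
    by move: close; rewrite -h => /and3P[].
  apply: (@meyniel_near_hole f m a b mey); split=> //.
  + by move=> i im; have /and3P[] := step _ im.
  + by have /and3P[] := close.
  + move=> i j ij jm eij; apply: chord => //.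
    by rewrite /r /= eij !fA //; lia.
exists S; split=> //.
  by move=> x y xS yS; have := Sst x y xS yS; rewrite /r /= !(subsetP SA) // !andbT.
move=> Q QA /cliqueP Qcl QS; have [|x xAQ xcl] := SQ Q QA _ QS.
  by move=> x y xQ yQ xy; rewrite /r /= Qcl // !(subsetP QA).
have ex y : y \in Q -> e x y by move/xcl/and3P=> [].
exists x => //; apply/cliqueP => y z; rewrite !inE.
case/predU1P=> [->|yQ]; case/predU1P=> [->|zQ]; first by rewrite eqxx.
- by move=> _; apply: ex.
- by move=> _; rewrite e_sym ex.
- exact: Qcl.
Qed.

End Meyniel.

(** * Weighted colourings and clique covers *)

Section Weights.
Variables (n : nat) (e : rel 'I_n).
Hypothesis e_irr : irreflexive e.
Hypothesis strong : strong_stable_sets e.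
Implicit Types (A K Q S : {set 'I_n}) (c w : 'I_n -> nat).

Definition weight w S := \sum_(x in S) w x.

Lemma clique_subset Q K : is_clique e K -> Q \subset K -> is_clique e Q.
Proof.
move/cliqueP => Kcl /subsetP QK; apply/cliqueP => x y /QK xK /QK yK.
exact: Kcl.
Qed.

Lemma card_clique_stable Q S : is_clique e Q -> stable e S -> #|Q :&: S| <= 1.
Proof.
move/cliqueP => Qcl Sst; apply/card_le1_eqP => x y.
rewrite !inE => /andP[xQ xS] /andP[yQ yS]; apply/eqP/negPn/negP => xy.
by have := Sst x y xS yS; rewrite Qcl // eq_sym.
Qed.

Lemma weight_sub w S A : S \subset A -> weight w S <= weight w A.
Proof. by move=> SA; rewrite /weight [leqRHS](big_setID S) /= (setIidPr SA) leq_addr. Qed.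

Lemma weight_minus w S K : {in S, forall x, 0 < w x} ->
  weight (fun x => w x - (x \in S)) K + #|K :&: S| = weight w K.
Proof.
move=> w0; rewrite -sum1_card /weight big_mkcond [X in _ + X]big_mkcond /=.
rewrite [RHS]big_mkcond -big_split; apply: eq_bigr => x _ /=; rewrite inE.
by case: ifP => //= _; case: ifP => [/w0|]; lia.
Qed.

Lemma sum_seq_weight w (z : seq {set 'I_n}) :
  \sum_(K <- z) weight w K = \sum_x w x * count (fun K => x \in K) z.
Proof.
rewrite /weight; under eq_bigr do rewrite big_mkcond.
rewrite exchange_big; apply: eq_bigr => x _ /=.
by rewrite -big_mkcond big_const_seq iter_addn_0 mulnC.
Qed.

Lemma sum_weight w (I : finType) (P : pred I) (F : I -> {set 'I_n}) :
  \sum_(i | P i) weight w (F i) = \sum_x w x * \sum_(i | P i) (x \in F i).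
Proof.
under [RHS]eq_bigr do rewrite big_distrr /=.
rewrite exchange_big; apply: eq_bigr => i _.
rewrite /weight big_mkcond; apply: eq_bigr => x _.
by case: ifP; rewrite ?muln1 ?muln0.
Qed.

Lemma weight_card K S : weight (fun x => (x \in S : nat)) K = #|K :&: S|.
Proof.
rewrite -sum1_card /weight big_mkcond [RHS]big_mkcond; apply: eq_bigr => x _.
by rewrite in_setI; case: (x \in K) => //=; case: (x \in S).
Qed.

(** Remove a strong stable set S of the support of c. A maximal clique of the
    support loses exactly one unit of weight, as it meets S, so the bound on
    the number of colours drops by one as well. *)
Lemma weighted_colouring c : exists L : seq {set 'I_n},
  [/\ {in L, forall S, stable e S},
       forall x, count (fun S => x \in S) L = c x &
       exists2 Q, is_clique e Q & size L <= weight c Q].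
Proof.
move: {2}(weight c setT) (leqnn (weight c setT)) => k.
elim: k c => [|k IH] c ck.
  exists [::]; split=> // [x|]; last by exists set0 => //; apply/cliqueP => x; rewrite inE.
  apply/esym/eqP; rewrite -leqn0 (leq_trans _ ck) // /weight (bigD1 x) //= ?inE //.
  by rewrite leq_addr.
pose A := [set x | 0 < c x].
have [A0|[v vA]] := set_0Vmem A.
  exists [::]; split=> // [x|]; last by exists set0 => //; apply/cliqueP => x; rewrite inE.
  by have := in_set0 x; rewrite -A0 inE lt0n; move/negbFE/eqP.
have [S [SA vS Sst SQ]] := strong vA.
have cS : {in S, forall x, 0 < c x} by move=> x /(subsetP SA); rewrite inE.
have [|L [Lst Lc [Q Qcl QL]]] := IH (fun x => c x - (x \in S)).
  have := weight_minus setT cS; rewrite setTI (cardsD1 v) vS; lia.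
exists (S :: L); split.
- by move=> S'; rewrite inE => /predU1P[->//|]; apply: Lst.
- by move=> x /=; rewrite Lc; case: (boolP (x \in S)) => [/cS|_] /=; lia.
have QAcl : is_clique e (Q :&: A) && (Q :&: A \subset A).
  by rewrite subsetIr (clique_subset Qcl) ?subsetIl.
have [K /maxsetP[/andP[Kcl KA] Kmax] QAK] :=
  maxset_exists (P := fun K => is_clique e K && (K \subset A)) QAcl.
exists K => //=; rewrite -(weight_minus K cS); apply: (@leq_trans (size L + 1)).
  by rewrite addn1.
apply: leq_add.
  rewrite (leq_trans QL) // (leq_trans _ (weight_sub _ QAK)) //.
  rewrite /weight (big_setID A) /= [X in _ + X]big1 ?addn0 // => x.
  by rewrite !inE -eqn0Ngt => /andP[/eqP->].
rewrite lt0n cards_eq0; apply/negP => /eqP KS0.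
have [|x] := SQ K KA Kcl; first by rewrite -setI_eq0 KS0.
rewrite inE => /andP[xK xA] xKcl.
have := Kmax (x |: K); rewrite xKcl subUset sub1set xA KA => /(_ isT (subsetUr _ _)).
by move/setP/(_ x); rewrite setU11 (negbTE xK).
Qed.
Definition stableb S := [forall x in S, forall y in S, ~~ e x y].

Lemma stableP S : reflect (stable e S) (stableb S).
Proof.
apply: (iffP forall_inP) => [h x y xS yS|h x xS].
  by have /forall_inP/(_ y yS) := h x xS.
by apply/forall_inP => y yS; apply: h.
Qed.

Lemma max_stable w : exists2 S, stable e S &
  forall S', stable e S' -> weight w S' <= weight w S.
Proof.
have st0 : stableb set0 by apply/stableP => x; rewrite inE.
have [S /stableP Sst Smax] := arg_maxnP (weight w) st0.
by exists S => // S' /stableP; apply: Smax.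
Qed.

Lemma stable_sub S S' : stable e S -> S' \subset S -> stable e S'.
Proof. by move=> Sst /subsetP SS x y /SS xS /SS yS; apply: Sst. Qed.

(** Lovasz's argument. Otherwise choose for each clique K a heaviest stable set
    F K that avoids K, and let c count the sets F K through each vertex. With t
    the number of cliques, each clique Q has c-weight less than t, as F Q
    contributes nothing, so fewer than t stable sets colour c. But their total
    w-weight is t times that of a heaviest stable set. *)
Lemma clique_meets_max_stable w v : 0 < w v ->
  exists2 K, is_clique e K &
  forall S, stable e S -> (forall S', stable e S' -> weight w S' <= weight w S) ->
    exists2 x, x \in K :&: S & 0 < w x.
Proof.
move=> wv; have [S0 S0st S0max] := max_stable w.
have w0 : 0 < weight w S0.
  apply: leq_trans wv (leq_trans _ (S0max [set v] _)).
    by rewrite /weight big_set1.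
  by move=> x y; rewrite !inE => /eqP-> /eqP->; rewrite e_irr.
pose supp := [set x | 0 < w x].
pose avoids K S := [&& stableb S, weight w S == weight w S0 & [disjoint K & S :&: supp]].
have [/existsP[K /andP[Kcl /existsPn K_all]]|all_av] :=
    boolP [exists K, is_clique e K && ~~ [exists S, avoids K S]].
  exists K => // S Sst Smax; have := K_all S; rewrite /avoids (introT (stableP S) Sst).
  rewrite eqn_leq S0max // Smax //= -setI_eq0 => /set0Pn[x].
  by rewrite !inE => /and3P[xK xS wx]; exists x; rewrite // inE xK.
pose F K := odflt set0 [pick S | avoids K S] :&: supp.
have FP K : is_clique e K ->
    [/\ stable e (F K), weight w (F K) = weight w S0 & [disjoint K & F K]].
  move=> Kcl; rewrite /F; case: pickP => [S /and3P[Sst /eqP wS dis]|none] /=.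
    split=> //; first by apply: stable_sub (subsetIl _ _); apply/stableP.
    rewrite -wS /weight [RHS](big_setID supp) /= [X in _ + X]big1 ?addn0 // => x.
    by rewrite !inE -eqn0Ngt => /andP[/eqP->].
  case/negP: all_av; apply/existsP; exists K; rewrite Kcl.
  by apply/existsPn => S; rewrite none.
pose c x : nat := \sum_(K | is_clique e K) (x \in F K).
have [L [Lst Lc [Q Qcl QL]]] := weighted_colouring c.
pose t := #|is_clique e|.
have cQ : weight c Q < t.
  rewrite /weight /c exchange_big /= /t -sum1_card (bigD1 Q) //=.
  rewrite [X in X + _]big1 => [|x xQ]; last first.
    by have [_ _ dis] := FP Q Qcl; rewrite (disjointFr dis xQ).
  rewrite add0n [X in _ < X](bigD1 Q) //= add1n ltnS leq_sum // => K /andP[Kcl _].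
  have [Fst _ _] := FP K Kcl; apply: leq_trans (card_clique_stable Qcl Fst).
  rewrite -sum1_card big_mkcond [X in _ <= X]big_mkcond leq_sum // => x _.
  by rewrite in_setI; case: (x \in Q) => //=; case: (x \in F K).
have eq1 : \sum_x w x * c x = t * weight w S0.
  rewrite /t -sum_nat_const -sum_weight.
  by apply: eq_bigr => K Kcl; have [_ -> _] := FP K Kcl.
have : \sum_x w x * c x <= size L * weight w S0.
  under eq_bigr do rewrite -Lc; rewrite -sum_seq_weight.
  rewrite big_seq; apply: (@leq_trans (\sum_(S <- L | S \in L) weight w S0)).
    by apply: leq_sum => S /Lst; apply: S0max.
  by rewrite -big_seq big_const_seq iter_addn_0 count_predT mulnC.
by rewrite eq1 leq_pmul2r // leqNgt (leq_ltn_trans QL).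
Qed.

(** Remove a clique that meets all heaviest stable sets: the maximal weight of
    a stable set drops. *)
Lemma weighted_clique_cover w : exists z : seq {set 'I_n},
  [/\ {in z, forall K, is_clique e K},
       forall x, count (fun K => x \in K) z = w x &
       exists2 S, stable e S & size z <= weight w S].
Proof.
move: {2}(weight w setT) (leqnn (weight w setT)) => k.
elim: k w => [|k IH] w wk.
  exists [::]; split=> // [x|]; last by exists set0 => // x; rewrite inE.
  apply/esym/eqP; rewrite -leqn0 (leq_trans _ wk) // /weight (bigD1 x) //= ?inE //.
  by rewrite leq_addr.
have [v wv|w0] := pickP (fun v => 0 < w v); last first.
  exists [::]; split=> // [x|]; last by exists set0 => // x; rewrite inE.
  by have := w0 x; rewrite lt0n; move/negbFE/eqP.
have [K Kcl Kmeets] := clique_meets_max_stable wv.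
have [S0 S0st S0max] := max_stable w.
pose K' := K :&: [set x | 0 < w x].
have wK' : {in K', forall x, 0 < w x} by move=> x; rewrite !inE => /andP[].
have meets S : stable e S -> (forall S', stable e S' -> weight w S' <= weight w S) ->
    0 < #|S :&: K'|.
  move=> Sst /(Kmeets S Sst)[x]; rewrite inE => /andP[xK xS] wx.
  by apply/card_gt0P; exists x; rewrite !inE xS xK.
have [|z [zcl zw [S Sst zS]]] := IH (fun x => w x - (x \in K')).
  rewrite -ltnS (leq_trans _ wk) // -[leqRHS](weight_minus setT wK') setTI.
  rewrite -[X in X < _]addn0 ltn_add2l (leq_trans (meets _ S0st S0max)) //.
  by rewrite subset_leq_card ?subsetIr.
exists (K' :: z); split.
- move=> Q; rewrite inE => /predU1P[->|]; last exact: zcl.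
  by apply: clique_subset Kcl _; apply: subsetIl.
- by move=> x /=; rewrite zw; case: (boolP (x \in K')) => [/wK'|_] /=; lia.
exists S0 => //=; apply: leq_ltn_trans zS _.
have [SS0|SS0|SS0] := ltngtP (weight w S) (weight w S0).
- by apply: leq_ltn_trans SS0; rewrite -(weight_minus S wK') leq_addr.
- by rewrite ltnNge S0max in SS0.
rewrite -SS0 -(weight_minus S wK') -[X in X < _]addn0 ltn_add2l.
by apply: meets => // S' /S0max; rewrite SS0.
Qed.

End Weights.

(** * Vertices of the covering polyhedron *)

Section Vertices.
Import Order.TTheory GRing.Theory Num.Theory.
Local Open Scope ring_scope.
Variables (R : realType) (n m : nat) (A : 'M[R]_(n, m)) (c : 'I_n -> R).
Hypothesis c_ge0 : forall i, 0 <= c i.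
Implicit Types (x y z d : 'rV[R]_n) (k : 'I_n + 'I_m).

(** Both families of inequalities of the polyhedron in the form 0 <= slack k x;
    slope k is the linear part of slack k. *)
Definition slack k x := match k with inl i => x 0 i | inr j => (x *m A) 0 j - 1 end.
Definition slope k d := match k with inl i => d 0 i | inr j => (d *m A) 0 j end.
Definition cost x := \sum_i c i * x 0 i.
Local Notation P := (covering_polyhedron A).

Lemma slack_line k x s d : slack k (x + s *: d) = slack k x + s * slope k d.
Proof.
case: k => [i|j] /=; first by rewrite !mxE.
by rewrite mulmxDl -scalemxAl mxE [(s *: (d *m A)) 0 j]mxE addrAC.
Qed.

Lemma cost_line x s d : cost (x + s *: d) = cost x + s * cost d.
Proof.
rewrite /cost mulr_sumr -big_split; apply: eq_bigr => i _ /=.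
by rewrite !mxE mulrDr mulrCA.
Qed.

Lemma covering_slack x : P x <-> forall k, 0 <= slack k x.
Proof.
split=> [[x0 xA] [i|j] //=|h]; first by rewrite subr_ge0.
by split=> [i|j]; [apply: (h (inl i)) | have := h (inr j); rewrite /= subr_ge0].
Qed.

Definition loose x := [set k | slack k x != 0].

(** Move along d up to the first inequality that becomes tight. There is one,
    as d has a negative coordinate. *)
Lemma descend x d i0 : P x -> (forall k, slack k x = 0 -> slope k d = 0) ->
  cost d <= 0 -> d 0 i0 < 0 ->
  exists x', [/\ P x', cost x' <= cost x & (#|loose x'| < #|loose x|)%N].
Proof.
move=> /covering_slack Px tight cd di0.
pose ratio k := slack k x / - slope k d.
have [k0 k0neg kmin] :=
  @Order.TotalTheory.arg_minP _ R _ (inl i0) (fun k => slope k d < 0) ratio di0.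
have s0 : 0 <= ratio k0 by rewrite divr_ge0 // oppr_ge0 ltW.
exists (x + ratio k0 *: d); split.
- apply/covering_slack => k; rewrite slack_line.
  have [kneg|kpos] := ltP (slope k d) 0; last by rewrite addr_ge0 // mulr_ge0.
  have := kmin k kneg; rewrite {2}/ratio ler_pdivlMr ?oppr_gt0 //.
  by rewrite mulrN -subr_ge0 opprK.
- by rewrite cost_line gerDl mulr_ge0_le0.
apply: proper_card; apply/properP; split.
  apply/subsetP => k; rewrite !inE slack_line; apply: contraNN => /eqP sk.
  by rewrite sk tight // mulr0 addr0.
exists k0; rewrite !inE; first by apply: contraTN k0neg => /eqP/tight->; rewrite ltxx.
rewrite slack_line /ratio negbK invrN mulrN mulNr mulfVK ?subrr //.
by rewrite lt_eqF.
Qed.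

(** A point that is not a vertex lies inside a segment of the polyhedron, whose
    direction preserves the tight inequalities. Up to sign this direction does
    not raise the cost and has a negative coordinate, because the coefficients
    of the cost are nonnegative; so [descend] applies, and the number of
    inequalities that are not tight decreases. *)
Lemma covering_vertex x : P x -> exists2 v, is_vertex P v & cost v <= cost x.
Proof.
elim/ltn_ind: {x}#|loose x| {-2}x (erefl #|loose x|) => k IH x xk Px.
have step d i0 : (forall k, slack k x = 0 -> slope k d = 0) ->
    cost d <= 0 -> d 0 i0 < 0 -> exists2 v, is_vertex P v & cost v <= cost x.
  move=> tight cd di0; have [x' [Px' cx' lx']] := descend Px tight cd di0.
  rewrite xk in lx'; have [v vP cv] := IH _ lx' x' erefl Px'.
  by exists v => //; apply: le_trans cx'.
have [[y [z [t [[Py Pz t01 xE] ne]]]]|no] := pselect (exists y z (t : R),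
    [/\ P y, P z, 0 < t < 1 & x = t *: y + (1 - t) *: z] /\ ~ (y = x /\ z = x));
  last first.
  exists x => //; split=> // y z t Py Pz t01 xE; apply: contrapT => ne.
  by apply: no; exists y, z, t.
move/andP: t01 => [t0 t1].
have xE1 : x = z + t *: (y - z).
  by rewrite xE scalerBr scalerBl scale1r addrC addrA addrAC.
have slack_diff k' : slack k' y = slack k' z + slope k' (y - z).
  by rewrite -[slope _ _]mul1r -slack_line scale1r addrC subrK.
have tight k' : slack k' x = 0 -> slope k' (y - z) = 0.
  have y0 := (covering_slack y).1 Py k'; have z0 := (covering_slack z).1 Pz k'.
  have := slack_diff k'; rewrite xE1 slack_line.
  set a := slack k' z in z0 *; set b := slack k' y in y0 *.
  set s := slope _ _; nra.
have [i di] : exists i, (y - z) 0 i != 0.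
  apply/existsP; rewrite -negb_forall; apply/negP => /forallP d0.
  have yz : y - z = 0 by apply/rowP => i; rewrite [RHS]mxE; apply/eqP/d0.
  apply: ne; move: xE1; rewrite yz scaler0 addr0 => ->.
  by move/eqP: yz; rewrite subr_eq0 => /eqP.
have costN : cost (- (y - z)) = - cost (y - z).
  have := cost_line 0 (-1) (y - z); rewrite scaleN1r add0r mulN1r => ->.
  by rewrite /cost big1 ?add0r // => j _; rewrite mxE mulr0.
have tightN k' : slack k' x = 0 -> slope k' (- (y - z)) = 0.
  move/tight; case: (k') => [j|j] /=.
    by rewrite [(- (y - z)) 0 j]mxE => ->; rewrite oppr0.
  by rewrite mulNmx [(- ((y - z) *m A)) 0 j]mxE => ->; rewrite oppr0.
have neg d : cost d < 0 -> exists i, d 0 i < 0.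
  move=> cd; have [/existsP//|/existsPn h] := boolP [exists i, d 0 i < 0].
  move: cd; rewrite ltNge /cost sumr_ge0 // => j _; rewrite mulr_ge0 //.
  by have := h j; rewrite -leNgt.
have [cd|cd|cd] := ltgtP (cost (y - z)) 0.
- by have [j dj] := neg _ cd; apply: (step _ j tight) => //; apply: ltW.
- have cdN : cost (- (y - z)) < 0 by rewrite costN oppr_lt0.
  by have [j dj] := neg _ cdN; apply: (step _ j tightN) => //; apply: ltW.
- move: di; rewrite neq_lt => /orP[di|di].
    by apply: (step _ i tight) => //; rewrite cd.
  by apply: (step _ i tightN); rewrite ?costN ?cd ?oppr0 // [(- (y - z)) 0 i]mxE oppr_lt0.
Qed.

End Vertices.

Definition hitting_set n (C : {set {set 'I_n}}) (S : {set 'I_n}) :=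
  [forall K in C, ~~ [disjoint K & S]].

Section Ideal.
Import Order.TTheory GRing.Theory Num.Theory.
Local Open Scope ring_scope.
Variables (R : realType) (n : nat) (C : {set {set 'I_n}}).
Hypothesis C_ideal : ideal R C.

(** The point c / N lies in the covering polyhedron; an integral vertex that
    costs no more is positive on a hitting set. *)
Lemma ideal_hitting_set (w c : 'I_n -> nat) N : (0 < N)%N ->
  (forall K, K \in C -> (N <= weight c K)%N) ->
  exists2 S, hitting_set C S & (N * weight w S <= \sum_x w x * c x)%N.
Proof.
move=> N0 Nc; pose A := clutter_matrix R C.
have NR : 0 < N%:R :> R by rewrite ltr0n.
pose x : 'rV[R]_n := \row_i ((c i)%:R / N%:R).
have xA (y : 'rV[R]_n) j : (y *m A) 0 j = \sum_(i in enum_val j) y 0 i.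
  rewrite mxE [RHS]big_mkcond /=; apply: eq_bigr => i _; rewrite mxE.
  by case: ifP => _; rewrite ?mulr1 ?mulr0.
have Px : covering_polyhedron A x.
  split=> [i|j]; first by rewrite mxE divr_ge0.
  rewrite xA; under eq_bigr do rewrite mxE.
  rewrite -mulr_suml -natr_sum ler_pdivlMr // mul1r ler_nat.
  exact: Nc (enum_valP j).
have [|v vP cv] := @covering_vertex R n _ A (fun i => (w i)%:R) _ x Px => //.
have [[v0 vA] _] := vP; have vint := C_ideal vP.
exists [set i | 1 <= v 0 i].
  apply/forall_inP => K KC; apply/negP => dis.
  have := vA (enum_rank_in KC K); rewrite xA enum_rankK_in // big1 ?ler10 // => i iK.
  have := disjointFr dis iK; rewrite inE => vi1.
  have /natrP[k vk] : v 0 i \is a Num.nat by rewrite -intrEge0 ?vint.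
  by move: vi1; rewrite vk ler1n; case: k {vk}.
rewrite -(ler_nat R) natrM mulrC -ler_pdivlMr //.
apply: le_trans (le_trans cv _).
  rewrite /weight natr_sum /cost big_mkcond; apply: ler_sum => i _.
  rewrite inE; case: ifP => [vi|_]; last by rewrite mulr_ge0.
  by rewrite ler_peMr.
rewrite /cost natr_sum mulr_suml; apply: ler_sum => i _.
by rewrite mxE natrM mulrA.
Qed.
End Ideal.

(** * Integral packings of maximal cliques *)

Section Packing.
Variables (n : nat) (e : rel 'I_n).
Hypotheses (n_gt0 : 0 < n) (e_irr : irreflexive e).
Hypothesis strong : strong_stable_sets e.
Local Notation C := (clique_clutter e).
Hypothesis blocking : forall (w c : 'I_n -> nat) N, 0 < N ->
  (forall K, K \in C -> N <= weight c K) ->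
  exists2 S, hitting_set C S & N * weight w S <= \sum_x w x * c x.
Implicit Types (K S T : {set 'I_n}) (w : 'I_n -> nat).

(** Let U be the part of S of positive weight and F v a lightest hitting set
    through v. The function c, the sum of the F v for v in U minus U itself,
    gives every maximal clique at least #|U| - 1, because a clique meets U at
    most once; so it costs at least (#|U| - 1) * tau, while the F v together
    cost #|U| * tau. *)
Lemma stable_weight_le w tau S :
  (forall T, hitting_set C T -> tau <= weight w T) ->
  (forall v, 0 < w v -> exists T, [/\ hitting_set C T, v \in T & weight w T = tau]) ->
  stable e S -> weight w S <= tau.
Proof.
move=> tau_min tight Sst; pose U := [set v in S | 0 < w v].
have Ust : stable e U by apply: stable_sub Sst _; apply/subsetP => x; rewrite inE => /andP[].
have -> : weight w S = weight w U.
  rewrite /weight big_mkcond [RHS]big_mkcond; apply: eq_bigr => x _.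
  by rewrite inE; case: (x \in S) => //=; case: ifP => // /negbT; rewrite -eqn0Ngt => /eqP.
pose opt v T := [&& hitting_set C T, v \in T & weight w T == tau].
pose F v := odflt set0 [pick T | opt v T].
have FP v : v \in U -> opt v (F v).
  rewrite inE /F => /andP[_ /tight[T [TC vT wT]]]; case: pickP => [//|/(_ T)].
  by rewrite /opt TC vT wT eqxx.
have [U0|[v0 v0U]] := set_0Vmem U; first by rewrite U0 /weight big_set0.
pose g x : nat := \sum_(v in U) (x \in F v).
have g_gt0 : {in U, forall x, 0 < g x}.
  move=> x xU; rewrite /g (bigD1 x) //=.
  by have /and3P[_ -> _] := FP x xU.
pose c x := g x - (x \in U).
have wc : \sum_x w x * c x + weight w U = #|U| * tau.
  have <- : \sum_(v in U) weight w (F v) = #|U| * tau.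
    rewrite -sum_nat_const; apply: eq_bigr => v vU.
    by have /and3P[_ _ /eqP] := FP v vU.
  rewrite sum_weight /weight [X in _ + X]big_mkcond -big_split.
  apply: eq_bigr => x _ /=; rewrite /c -/(g x).
  have := g_gt0 x; case: (x \in U) => [/(_ isT) gx|_]; last by rewrite subn0 addn0.
  by rewrite -mulnSr subn1 prednK.
have cK K : K \in C -> #|U|.-1 <= weight c K.
  move=> KC; rewrite -subn1 leq_subLR.
  have Kcl : is_clique e K by move: KC; rewrite inE => /maxsetP[].
  apply: leq_trans (leq_add (card_clique_stable Kcl Ust) (leqnn _)).
  rewrite addnC (weight_minus K g_gt0) /weight exchange_big /= -sum1_card.
  apply: leq_sum => v vU; have /and3P[/forall_inP/(_ K KC) FK _ _] := FP v vU.
  by move: FK; rewrite -setI_eq0 -cards_eq0 -weight_card -lt0n.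
have [U1|U1] := leqP #|U| 1.
  have := leq_trans (leq_addl _ _) (eq_leq wc); move/leq_trans; apply.
  by rewrite -[leqRHS]mul1n leq_mul2r U1 orbT.
have [||T TC NT] := @blocking w c #|U|.-1; [by rewrite -subn1 subn_gt0| exact: cK |].
have : #|U|.-1 * tau + weight w U <= #|U| * tau.
  rewrite -wc leq_add2r; apply: leq_trans NT.
  by rewrite leq_mul2l tau_min ?orbT.
by rewrite -{2}(prednK (ltnW U1)) mulSn addnC leq_add2r.
Qed.

(** A maximal clique without vertices of weight 0 lies in the support of w, and
    being maximal it cannot extend there. *)
Lemma zero_hitting_set w S u :
  (forall Q : {set 'I_n}, Q \subset u |: [set x | 0 < w x] -> is_clique e Q ->
     [disjoint Q & S] -> exists2 x, x \in (u |: [set x | 0 < w x]) :\: Q &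
       is_clique e (x |: Q)) ->
  hitting_set C (S :|: [set x | w x == 0]).
Proof.
move=> SQ; apply/forall_inP => K; rewrite inE => /maxsetP[Kcl Kmax].
apply/negP => dis.
have KS : [disjoint K & S] by apply: disjointWr dis; apply: subsetUl.
have K0 x : x \in K -> w x != 0.
  by move=> xK; have := disjointFr dis xK; rewrite !inE => /norP[].
have [|x] := SQ K _ Kcl KS.
  by apply/subsetP => x /K0; rewrite !inE lt0n => ->; rewrite orbT.
rewrite !inE => /andP[xK _] xKcl; case/negP: xK.
by rewrite -(Kmax _ xKcl (subsetUr _ _)) setU11.
Qed.

(** If lowering the weight of v by 1, as in [less v], keeps the least weight of
    a hitting set, induct. Otherwise all vertices of positive weight are tight
    and every clique of a smallest clique cover is maximal: if K0 in it extends
    by u, a strong stable set through u misses K0 and so is too light. *)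
Lemma clique_packing w : exists z : seq {set 'I_n},
  [/\ {subset z <= C}, forall x, count (fun K => x \in K) z <= w x &
       exists2 T, hitting_set C T & weight w T <= size z].
Proof.
elim/ltn_ind: {w}(weight w setT) {-2}w (erefl (weight w setT)) => k IH w wk.
have hT : hitting_set C setT.
  apply/forall_inP => K; rewrite inE => /maxsetP[Kcl Kmax].
  rewrite -setI_eq0 setIT; apply/eqP => K0.
  have := Kmax [set Ordinal n_gt0]; rewrite K0 sub0set => /(_ _ isT) => h.
  have : is_clique e [set Ordinal n_gt0].
    apply/cliqueP => x y; rewrite !inE => /eqP-> /eqP->; by rewrite eqxx.
  by move/h/setP/(_ (Ordinal n_gt0)); rewrite !inE eqxx.
have [T0 T0h T0min] := arg_minnP (weight w) hT.
pose less v x := w x - (x \in [set v]).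
have weight_less v S : 0 < w v -> weight (less v) S + #|S :&: [set v]| = weight w S.
  by move=> wv; apply: weight_minus => x; rewrite inE => /eqP->.
have [[v [wv vmin]]|no] := pselect (exists v, 0 < w v /\
    forall T, hitting_set C T -> weight w T0 <= weight (less v) T).
  have [|z [zC zw [T Th Tz]]] := IH (weight (less v) setT) _ (less v) erefl.
    by rewrite -wk -(weight_less v) // setTI cards1 addn1.
  exists z; split=> //; last by exists T0 => //; apply: leq_trans (vmin T Th) Tz.
  by move=> x; apply: leq_trans (zw x) (leq_subr _ _).
have tight v : 0 < w v -> exists T, [/\ hitting_set C T, v \in T & weight w T = weight w T0].
  move=> wv; apply: contrapT => no_T; apply: no; exists v; split=> // T Th.
  have := T0min T Th; rewrite leq_eqVlt => /predU1P[eqT|ltT].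
    have vT : v \notin T by apply/negP => vT; apply: no_T; exists T.
    rewrite eqT -(weight_less v T wv) (_ : #|_| = 0) ?addn0 //.
    by apply/eqP; rewrite cards_eq0 setI_eq0 disjoint_sym disjoints1.
  rewrite -ltnS; apply: leq_trans ltT _; rewrite -(weight_less v T wv) -addn1.
  by rewrite leq_add2l -(cards1 v) subset_leq_card ?subsetIr.
have [z [zcl zw [S0 S0st S0z]]] := weighted_clique_cover e_irr strong w.
have ztau : size z <= weight w T0.
  by apply: leq_trans S0z _; apply: stable_weight_le S0st.
have heavy u : exists S, [/\ stable e S, u \in S & weight w T0 <= weight w S].
  have [S [_ uS Sst SQ]] := strong (setU11 u [set x | 0 < w x]).
  exists S; split=> //; apply: leq_trans (T0min _ (zero_hitting_set SQ)) _.
  rewrite /weight big_mkcond [leqRHS]big_mkcond; apply: leq_sum => x _ /=.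
  by rewrite in_setU in_set; case: (x \in S) => //=; case: eqP => // ->.
have weight_z S : weight w S = \sum_(K <- z) #|K :&: S|.
  under eq_bigr do rewrite -weight_card.
  rewrite sum_seq_weight /weight big_mkcond; apply: eq_bigr => x _.
  by rewrite zw; case: (x \in S); rewrite ?mul1n ?mul0n.
exists z; split.
- move=> K0 K0z; rewrite inE; have [K Kmax K0K] := maxset_exists (zcl _ K0z).
  have [->//|K0neK] := eqVneq K0 K.
  have [u uK uK0] : exists2 u, u \in K & u \notin K0.
    have : K0 \proper K by rewrite properEneq K0neK.
    by case/properP => _ [u uK uK0]; exists u.
  have [S [Sst uS T0S]] := heavy u.
  have K0S : K0 :&: S = set0.
    apply/setP => x; rewrite in_setI in_set0; apply/negP => /andP[xK0 xS].
    have [/cliqueP Kcl _] := maxsetP Kmax.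
    have ux : u != x by apply: contraNneq uK0 => ->.
    by have := Sst u x uS xS; rewrite (Kcl u x uK (subsetP K0K x xK0) ux).
  have : weight w S < size z.
    rewrite weight_z -(count_predC (pred1 K0) z) -add1n; apply: leq_add.
      by rewrite -has_count has_pred1.
    rewrite -sum1_count big_mkcond [leqRHS]big_mkcond /= !big_seq leq_sum // => K' K'z.
    case: eqP => [->|_] /=; first by rewrite K0S cards0.
    exact: card_clique_stable (zcl _ K'z) Sst.
  by rewrite ltnNge (leq_trans ztau T0S).
- by move=> x; rewrite zw.
exists T0 => //; have [S [Sst _ T0S]] := heavy (Ordinal n_gt0).
apply: leq_trans T0S _; rewrite weight_z -sum1_size !big_seq leq_sum // => K Kz.
exact: card_clique_stable (zcl _ Kz) Sst.
Qed.

End Packing.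

Section Duality.
Import Order.TTheory GRing.Theory Num.Theory.
Local Open Scope ring_scope.

(** Weak duality: a hitting set T of weight at most the number of cliques in z
    bounds the value of all fractional packings. *)
Lemma packing_mfmc (R : realType) n (C : {set {set 'I_n}}) :
  (forall w : 'I_n -> nat, exists z : seq {set 'I_n},
    [/\ {subset z <= C}, forall x : 'I_n, (count (fun K : {set 'I_n} => x \in K) z <= w x)%N &
       exists2 T, hitting_set C T & (weight w T <= size z)%N]) -> mfmc R C.
Proof.
move=> packing w; have [z [zC zw [T Th Tz]]] := packing (fun i => w i 0).
pose mult (j : 'I_#|C|) := count_mem (enum_val j) z.
pose y : 'cV[R]_#|C| := \col_j (mult j)%:R.
have AE (u : 'cV[R]_#|C|) i : (clutter_matrix R C *m u) i 0 =
    \sum_j (i \in (enum_val j : {set 'I_n}))%:R * u j 0.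
  by rewrite mxE; apply: eq_bigr => j _; rewrite mxE.
have sum_mult (P : {set 'I_n} -> nat) :
    (\sum_(j < #|C|) P (enum_val j) * mult j = \sum_(K <- z) P K)%N.
  transitivity (\sum_(K in C) P K * count_mem K z)%N; first by rewrite [RHS]big_enum_val.
  under eq_bigr do rewrite -sum1_count big_mkcond big_distrr /=.
  rewrite exchange_big [LHS]big_seq [RHS]big_seq; apply: eq_bigr => K /zC KC /=.
  rewrite (bigD1 K) //= eqxx muln1 big1 ?addn0 // => K' /andP[_ K'K].
  by rewrite eq_sym (negbTE K'K) muln0.
exists y; split; last by move=> i j; rewrite mxE; apply: natr_int.
split.
  split=> [j|i]; first by rewrite mxE.
  rewrite AE; under eq_bigr do rewrite mxE -natrM.
  rewrite -natr_sum ler_nat (sum_mult (fun K => i \in K : nat)); apply: leq_trans (zw i).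
  rewrite -sum1_count [leqRHS]big_mkcond /=; apply: eq_leq.
  by apply: eq_bigr => K _; case: (i \in K).
move=> u [u0 uw]; apply: (@le_trans _ _ (weight (fun i => w i 0) T)%:R).
  apply: (@le_trans _ _ (\sum_(i in T) (clutter_matrix R C *m u) i 0)).
    under [leRHS]eq_bigr do rewrite AE.
    rewrite exchange_big /=; apply: ler_sum => j _.
    rewrite -mulr_suml ler_peMl // -natr_sum ler1n.
    have /forall_inP/(_ _ (enum_valP j)) := Th.
    rewrite -setI_eq0 => /set0Pn[x]; rewrite inE => /andP[xj xT].
    by rewrite (bigD1 x) //= xj.
  by rewrite /weight natr_sum; apply: ler_sum => i _; apply: uw.
under eq_bigr do rewrite mxE; rewrite -natr_sum ler_nat.
apply: leq_trans Tz _; have := sum_mult (fun=> 1%N); rewrite sum1_size => <-.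
by apply: eq_leq; apply: eq_bigr => j _; rewrite mul1n.
Qed.
End Duality.

Theorem theorem3p1 (R : realType) (n : nat) (hn : (0 < n)%N) (e : rel 'I_n)
    (e_sym : symmetric e) (e_irr : irreflexive e)
    (e_meyniel : meyniel e) (e_noiso : no_isolated_vertex e)
    (C_ideal : ideal R (clique_clutter e)) :
  mfmc R (clique_clutter e).
Proof.
apply: packing_mfmc => w; apply: clique_packing => //.
  exact: meyniel_strong_stable_sets.
by move=> w' c N; apply: (ideal_hitting_set C_ideal).
Qed.
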